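(* Let $T_h$ be the complete infinitary tree of height $h$. Then $$p(T_h)=F_{h+3}-1,$$ where $F_n$ denotes the $n$th Fibonacci number and $p(T_h)$ denotes the optimal-pegging number of $T_h$.
   Context: A distribution $D$ of pegs on a graph $G$ is a subset of $V(G)$ (the vertices holding one peg each). A pegging move from $D$ to $D'$: there are distinct vertices $u,v\in D$ and $w\notin D$ with both $u$ and $w$ adjacent to $v$, and $D'=(D\setminus\{u,v\})\cup\{w\}$. A vertex $x$ is reachable from $D$ if some finite (possibly empty) sequence of pegging moves starting at $D$ yields a distribution containing $x$. The reach $R(D)$ is the set of vertices reachable from $D$; $G$ can be pegged by $D$ if $R(D)=V(G)$. The optimal-pegging number $p(G)$ is the minimum size of a distribution on $G$ that can peg $G$. The complete infinitary tree of height $h$ is the tree rooted at a vertex $r$ such that every non-leaf vertex has countably infinitely many children and every leaf is at distance exactly $h$ from $r$. Fibonacci numbers are indexed by $F_1=F_2=1$, $F_{n+2}=F_{n+1}+F_n$. *)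

(* Defs.v *)
From Stdlib Require Import Relation_Operators.
From mathcomp Require Import all_boot.
From mathcomp Require Import boolp classical_sets functions cardinality.

Set Implicit Arguments.
Unset Strict Implicit.
Unset Printing Implicit Defensive.

Local Open Scope classical_set_scope.
Local Open Scope card_scope.

(* Possibly infinite simple graphs. *)
Record sgraph := SGraph {
  vertex :> Type;
  adj : vertex -> vertex -> Prop;
  adj_sym : forall u v, adj u v -> adj v u;
  adj_irrefl : forall v, ~ adj v v
}.

Section Pegging.
Variable G : sgraph.
Implicit Types D : set G.

(* The peg on u jumps over the peg on v, which is removed, and lands on w. *)
Definition pegging_move D D' : Prop :=
  exists u v w : G,
    [/\ u <> v, D u, D v & ~ D w] /\
    [/\ adj u v, adj w v & D' = (D `\` [set u; v]) `|` [set w]].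

Definition reachable D (x : G) : Prop :=
  exists2 D', clos_refl_trans (set G) pegging_move D D' & D' x.

Definition reach D : set G := [set x | reachable D x].

Definition can_be_pegged_by D : Prop := reach D = [set: G].

(* The comparison of sizes in the second conjunct is one of cardinals, so D
   ranges over infinite distributions as well. *)
Definition optimal_pegging_number (n : nat) : Prop :=
  (exists2 D, can_be_pegged_by D & D #= `I_n) /\
  (forall D, can_be_pegged_by D -> `I_n #<= D).

End Pegging.

(* A vertex is the sequence of child indices read along the path from the
   root, so its length is its distance to the root [::]. *)
Definition inftree_vertex (h : nat) := {s : seq nat | size s <= h}.

Definition inftree_child h (u v : inftree_vertex h) : Prop :=
  exists n : nat, val v = rcons (val u) n.

Definition inftree_adj h (u v : inftree_vertex h) : Prop :=
  inftree_child u v \/ inftree_child v u.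

Lemma inftree_adj_sym h (u v : inftree_vertex h) :
  inftree_adj u v -> inftree_adj v u.
Proof. by case=> ?; [right | left]. Qed.

Lemma inftree_adj_irrefl h (v : inftree_vertex h) : ~ inftree_adj v v.
Proof.
by case=> -[n] /(congr1 size) /eqP;
  rewrite size_rcons (ltn_eqF (ltnSn _)).
Qed.

Definition inftree (h : nat) : sgraph :=
  SGraph (@inftree_adj_sym h) (@inftree_adj_irrefl h).

Lemma inftree_parent_unique h (u u' v : inftree_vertex h) :
  inftree_child u v -> inftree_child u' v -> u = u'.
Proof.
by case=> n vE [m vE']; apply: val_inj; move: vE'; rewrite vE => /rcons_inj [].
Qed.

Lemma inftree_parent_exists h (v : inftree_vertex h) :
  val v <> [::] -> exists u, inftree_child u v.
Proof.
case: v => s /=; case/lastP: s => // s n sh _.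
have sh' : size s <= h by rewrite size_rcons in sh; exact: ltnW.
by exists (exist _ s sh'), n.
Qed.

Lemma inftree_children_infinite h (v : inftree_vertex h) :
  size (val v) < h -> [set w | inftree_child v w] #= [set: nat].
Proof.
move=> vh.
have szP n : size (rcons (val v) n) <= h by rewrite size_rcons.
pose f n : inftree_vertex h := exist _ (rcons (val v) n) (szP n).
have -> : [set w | inftree_child v w] = f @` setT.
  apply/seteqP; split=> [w [n wE]|w [n _ <-]]; last by exists n.
  by exists n => //; apply: val_inj.
apply: inj_card_eq => m n _ _ /(congr1 val) /rcons_inj [].
by [].
Qed.

Lemma inftree_leaf h (v : inftree_vertex h) :
  size (val v) = h -> [set w | inftree_child v w] = set0.
Proof.
move=> vh; rewrite -subset0 => w [n wE].
by have := valP w; rewrite /= wE size_rcons vh ltnn.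
Qed.

Fixpoint fib (n : nat) : nat :=
  match n with
  | 0 => 0
  | 1 => 1
  | (m.+1 as k).+1 => fib k + fib m
  end.

(* Main.v *)
Require Import Defs.
From mathcomp Require Import all_boot.
From Stdlib Require Import Relation_Operators.
From mathcomp Require Import boolp classical_sets functions cardinality finmap zify.

(** Lower bound. A finite distribution leaves some child [:: k] of the root with
    an empty branch; fix the leaf nseq h k there. To first approximation a
    vertex is worth the number of pegs needed outside the branch to bring a peg
    to it: 1 outside the branch, 2 at the root (one peg jumps over another),
    and for each vertex on the way to the leaf the sum of the values of the two
    pegs used up by the jump that lands there, hence Fibonacci numbers, up to
    fib (h + 3) at the leaf. With suitable
    values on the side branches no move increases the total value
    (weight_jump). A distribution D that misses the branch has total value at
    most |D| + 1, the extra 1 being due to a peg on the root, so that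
    |D| >= fib (h + 3) - 1 (pegging_size_ge). An infinite D is trivially large
    enough.

    Upper bound. Bringing a peg to depth i of an empty branch takes one peg at
    depth i - 1 and then one at depth i - 2, hence fib i.+1 arrivals at the root
    and, for the arrivals at depth 1, fib i jumps of a peg on a child of the
    root over the root. One arrival at the root is provided by a peg that sits
    there initially; any other one by a pair consisting of a child of the root
    and a child of that child. The root, fib h.+1 - 1 pairs and fib h single
    children of the root make 1 + 2 (fib h.+1 - 1) + fib h = fib (h + 3) - 1
    pegs, and they reach every vertex of every branch that they miss
    (covers_climb started at the root). If the target lies below a child of the
    root that already holds a peg, the root peg jumps over that child directly
    to depth 2, in the direction of the target; this saves two arrivals at the
    root and one jump over it, which makes up for the loss of the pegs in that
    branch, and the climb continues from depth 2 (covers_optimal_words). *)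

Set Implicit Arguments.
Unset Strict Implicit.
Unset Printing Implicit Defensive.

(** * Fibonacci numbers *)

Local Arguments fib : simpl never.

Lemma fibSS n : fib n.+2 = fib n.+1 + fib n.
Proof. by []. Qed.

Lemma fib_gt0 n : 0 < fib n.+1.
Proof. by elim: n => // n IHn; rewrite fibSS addn_gt0 IHn. Qed.

Lemma fib_homo : {homo fib : m n / m <= n}.
Proof.
apply: homo_leq => [//||[//|n]]; first exact: leq_trans.
by rewrite fibSS leq_addr.
Qed.

Lemma fib_leS n : fib n <= fib n.+1.
Proof. exact: fib_homo. Qed.

(** * A potential that no move increases *)

(** Adjacency in the tree without the height bound, so that the potential can
    be studied on plain sequences. *)
Definition word_adj (u v : seq nat) : Prop :=
  (exists n, v = rcons u n) \/ (exists n, u = rcons v n).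

(** The value of y for the branch through k, k, k, etc.: [find] counts how far y
    follows that path, and a vertex on the path is worth one Fibonacci step more
    than a vertex hanging off it at the same point. On the path the values are
    fib 3, fib 4, etc.; everything that leaves the path at depth n is worth
    fib n.+2, the least value for which such a peg can jump over the path vertex
    at depth n to the next one. *)
Definition weight (k : nat) (y : seq nat) : nat :=
  fib (find (predC1 k) y + (2 + all (pred1 k) y)).

Lemma rcons_nseq (T : Type) n (x : T) : rcons (nseq n x) x = nseq n.+1 x.
Proof. by rewrite -addn1 nseqD cats1. Qed.

Lemma weight_straight k n : weight k (nseq n k) = fib n.+3.
Proof.
rewrite /weight all_nseq /= eqxx orbT.
have /hasPn/hasNfind-> : {in nseq n k, forall c, ~~ predC1 k c}.
  by move=> c /nseqP[-> _] /=; rewrite eqxx.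
by rewrite size_nseq addnC.
Qed.

Lemma weight_off_rcons k n c :
  c != k -> weight k (rcons (nseq n k) c) = fib n.+2.
Proof.
move=> ck; rewrite /weight all_rcons /= (negPf ck) -cats1 find_cat has_nseq /=.
by rewrite eqxx andbF /= ck size_nseq !addn0 addn2.
Qed.

Lemma weight_rcons k y c :
  ~~ all (pred1 k) y -> weight k (rcons y c) = weight k y.
Proof.
move=> yk; rewrite /weight all_rcons (negPf yk) andbF -cats1 find_cat.
by move: yk; rewrite -has_predC => ->.
Qed.

Lemma weight_child k n c :
  weight k (rcons (nseq n k) c) = fib n.+4 \/
  weight k (rcons (nseq n k) c) = fib n.+2 /\
    forall d, weight k (rcons (rcons (nseq n k) c) d) = fib n.+2.
Proof.
have [->|ck] := eqVneq c k.
  by left; rewrite rcons_nseq weight_straight.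
right; rewrite weight_off_rcons //; split=> // d.
by rewrite weight_rcons ?weight_off_rcons // all_rcons /= (negPf ck).
Qed.

Lemma weight_grandchild_le k n c d :
  weight k (rcons (rcons (nseq n k) c) d) <= fib n.+3 + weight k (rcons (nseq n k) c).
Proof.
have [->|ck] := eqVneq c k.
  rewrite rcons_nseq weight_straight.
  have := fibSS n.+3; have := fib_leS n.+3; have := fib_leS n.+4.
  by case: (weight_child k n.+1 d) => [->|[-> _]]; lia.
have [_|[-> ->]] := weight_child k n c; last lia.
by rewrite weight_rcons ?leq_addl // all_rcons /= (negPf ck).
Qed.

(** A jump down the path is tight by the defining recurrence of the Fibonacci
    numbers, and so is one from a child over its parent on the path to the next
    path vertex; two vertices of the same side branch have the same weight. The
    last three of the four cases are the jumps downwards, upwards, and between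
    two children of v. *)
Lemma weight_jump k u v w : word_adj u v -> word_adj w v ->
  weight k w <= weight k u + weight k v.
Proof.
have straightP y : ~~ all (pred1 k) y \/ exists n, y = nseq n k.
  by case: (boolP (all _ y)) => [/all_pred1P ->|]; [right; exists (size y)|left].
move=> [] [a ->] [] [b].
- move/rcons_inj=> [-> _]; exact: leq_addr.
- move=> ->; have [?|[n ->]] := straightP u.
    by rewrite !weight_rcons ?all_rcons ?negb_and; lia.
  by rewrite weight_straight weight_grandchild_le.
- move=> ->; have [?|[n ->]] := straightP w.
    rewrite !weight_rcons ?leq_addr // all_rcons negb_and; apply/orP; by right.
  rewrite weight_straight; have [->|[-> ->]] := weight_child k n b.
    have := fib_leS n.+3; lia.
  rewrite fibSS; have := fib_leS n.+1; lia.
- move=> ->; have [?|[n ->]] := straightP v.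
    by rewrite !weight_rcons // leq_addr.
  rewrite weight_straight; have := fibSS n.+2.
  case: (weight_child k n a) => [->|[-> _]];
  case: (weight_child k n b) => [->|[-> _]]; have := fib_leS n.+2; have := fib_leS n.+3; lia.
Qed.

(** * The lower bound *)

Local Open Scope classical_set_scope.
Local Open Scope card_scope.

Section InfTree.
Variable h : nat.
Implicit Types (D : set (inftree h)) (L M : seq (seq nat)).

(** Distributions may be infinite in general, so the total weight is taken over a
    list that contains the distribution; a move is mirrored on the list, and the
    list may keep entries that hold no peg. *)
Lemma pegging_weight_le k D D' L :
  clos_refl_trans _ (@pegging_move (inftree h)) D D' ->
  (forall v, D v -> val v \in L) ->
  exists2 L', (forall v, D' v -> val v \in L') &
    \sum_(y <- L') weight k y <= \sum_(y <- L) weight k y.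
Proof.
move=> DD'; elim: DD' L => {D D'} [D D' DD'|D|D1 D2 D3 _ IH12 _ IH23] L DL.
- have [u [v [w [[uv Du Dv Dw] [/(weight_jump k) wle /wle {}wle ->]]]]] := DD'.
  have uL := DL _ Du.
  have vuL : val v \in rem (val u) L.
    have := DL _ Dv; rewrite (perm_mem (perm_to_rem uL)) inE => /orP[|//].
    by move=> /eqP /val_inj vu; case: uv.
  have Lperm : perm_eq L (val u :: val v :: rem (val v) (rem (val u) L)).
    by rewrite (perm_trans (perm_to_rem uL)) // perm_cons perm_to_rem.
  exists (val w :: rem (val v) (rem (val u) L)); last first.
    by rewrite (perm_big _ Lperm) /= !big_cons; move: wle; rewrite /=; lia.
  move=> x [[Dx xuv]|->]; last exact: mem_head.
  have := DL _ Dx; rewrite (perm_mem Lperm) !inE => /or3P[/eqP/val_inj xu|/eqP/val_inj xv|->].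
  + by case: xuv; left.
  + by case: xuv; right.
  + by rewrite orbT.
- by exists L.
- have [L2 D2L2 le12] := IH12 _ DL; have [L3 D3L3 le23] := IH23 _ D2L2.
  by exists L3 => //; exact: leq_trans le12.
Qed.

(** Outside the branch of k only the root weighs more than 1, namely 2. *)
Lemma sum_weight_fresh k L : uniq L ->
  (forall y t, y \in L -> y <> k :: t) ->
  \sum_(y <- L) weight k y <= (size L).+1.
Proof.
move=> Luniq Lk.
apply: (@leq_trans (\sum_(y <- L) (1 + (y == [::])))).
  rewrite big_seq [leqRHS]big_seq; apply: leq_sum => -[|c t] yL //.
  rewrite /weight /=; have [ck|] := eqVneq c k; last by [].
  by case: (Lk _ t yL); rewrite ck.
rewrite big_split /= sum1_size -big_mkcond /= sum1_count.
by rewrite (count_uniq_mem _ Luniq) -addn1 leq_add2l leq_b1.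
Qed.

Lemma pegging_size_ge D : can_be_pegged_by D -> `I_(fib (h + 3) - 1) #<= D.
Proof.
move=> Dpegs; have [Dfin|/infiniteP] := pselect (finite_set D); last first.
  exact: card_le_trans (subset_card_le _).
have /finite_setP[m Dm] := Dfin.
rewrite (card_le_eqr Dm) card_le_II.
have valDm : [set val v | v in D] #= `I_m.
  by rewrite (card_eql (inj_card_eq _)) //; apply: in2W; exact: val_inj.
pose L : seq (seq nat) := fset_set [set val v | v in D].
have Lm : size L = m := card_fset_set valDm.
have DL v : D v -> val v \in L.
  move=> Dv; have valDfin : finite_set [set val v | v in D].
    by apply/finite_setP; exists m.
  by rewrite (in_fset_set valDfin); apply: mem_set; exists v.
(* No vertex of D lies below [:: k]. *)
pose k := (\max_(y <- L) head 0 y).+1.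
have Lk y t : y \in L -> y <> k :: t.
  move=> yL yE; have := @leq_bigmax_seq _ L xpredT (head 0) y yL isT.
  by rewrite yE /= ltnn.
have xh : size (nseq h k) <= h by rewrite size_nseq.
have : reach D (exist _ (nseq h k) xh : inftree_vertex h) by rewrite Dpegs.
move=> [D' DD' D'x].
have [L' D'L' le'] := pegging_weight_le k DD' DL.
move: le'; rewrite (perm_big _ (perm_to_rem (D'L' _ D'x))) big_cons /=.
rewrite weight_straight => le'.
have := sum_weight_fresh (fset_uniq _) Lk; rewrite Lm addn3 -/L.
lia.
Qed.

(** * Reaching pegs from pegs *)

(** Pegs on L suffice to bring pegs to all of M simultaneously. Quantifying over
    all distributions that contain L makes superfluous pegs harmless, so that
    the relation is transitive and monotone, and the occupation of a landing
    vertex never has to be tracked. *)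
Definition covers L M : Prop :=
  forall D, (forall v, val v \in L -> D v) ->
  exists2 D', clos_refl_trans _ (@pegging_move (inftree h)) D D' &
    forall v : inftree_vertex h, val v \in M -> D' v.

Lemma covers_sub L M : {subset M <= L} -> covers L M.
Proof.
by move=> ML D DL; exists D; [exact: rt_refl|move=> v /ML /DL].
Qed.

Lemma covers_trans L M N : covers L M -> covers M N -> covers L N.
Proof.
move=> LM MN D /LM[D1 DD1 /MN[D2 D12 D2N]].
by exists D2 => //; exact: rt_trans D12.
Qed.

(** The vertex w may already be occupied: then the move is illegal, but there is
    nothing to do. *)
Lemma covers_jump u v w L : size u <= h -> size v <= h -> size w <= h ->
  word_adj u v -> word_adj w v -> u != v -> u \notin L -> v \notin L ->
  covers [:: u, v & L] (w :: L).
Proof.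
move=> uh vh wh uv wv neq_uv uL vL D DL.
pose node s (sh : size s <= h) : inftree h := exist _ s sh.
have [Dw|Dw] := pselect (D (node w wh)).
  exists D; first exact: rt_refl.
  move=> x; rewrite inE => /orP[/eqP xw|xL].
    by have -> : x = node w wh by exact: val_inj.
  by apply: DL; rewrite !inE xL !orbT.
exists ((D `\` [set node u uh; node v vh]) `|` [set node w wh]).
  apply: rt_step; exists (node u uh), (node v vh), (node w wh); split; last by split.
  split=> //; last 2 first.
  - by apply: DL; rewrite !inE eqxx.
  - by apply: DL; rewrite !inE eqxx orbT.
  by move=> [] /eqP; rewrite (negPf neq_uv).
move=> x; rewrite inE => /orP[/eqP xw|xL].
  by right; exact: val_inj.
left; split; first by apply: DL; rewrite !inE xL !orbT.
by move=> [] xE; move: xL; rewrite xE; apply/negP.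
Qed.

(** Each b in ps stands for a pair that can put one peg on the root; each c in ss
    for a peg that can jump over the root. *)
Definition supply (ps ss : seq nat) : seq (seq nat) :=
  [seq [:: b] | b <- ps] ++ [seq [:: b; 0] | b <- ps] ++ [seq [:: c] | c <- ss].

Lemma supply_head ps ss c t : c :: t \in supply ps ss -> c \in ps ++ ss.
Proof.
by rewrite !mem_cat => /or3P[] /mapP[d dL [-> _]]; rewrite dL ?orbT.
Qed.

Lemma supply_sub ps ps' ss ss' : {subset ps <= ps'} -> {subset ss <= ss'} ->
  {subset supply ps ss <= supply ps' ss'}.
Proof.
move=> pp ss_ y; rewrite !mem_cat => /or3P[] /mapP[d dL ->].
- by rewrite map_f ?pp.
- by rewrite (map_f (fun b => [:: b; 0])) ?pp ?orbT.
- by rewrite (map_f (fun b => [:: b]) (ss_ _ dL)) !orbT.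
Qed.

Lemma supply_nil ps ss : [::] \notin supply ps ss.
Proof. by apply/negP; rewrite !mem_cat => /or3P[] /mapP[]. Qed.

(** Pegs deeper than i in the branch of k: work on the first i levels of that
    branch, and on other branches, leaves them in place. *)
Definition beyond k i (X : seq (seq nat)) : Prop :=
  forall y, y \in X -> i < size y /\ head 0 y = k.

Lemma beyond_other k i X c t : beyond k i X -> c != k -> c :: t \notin X.
Proof. by move=> Xk; apply: contra => /Xk[_ /= ->]. Qed.

Lemma beyond_short k i X y : beyond k i X -> size y <= i -> y \notin X.
Proof. by move=> Xk; rewrite leqNgt; apply: contra => /Xk[]. Qed.

Lemma covers_root k i ps ss X b : 1 < h -> uniq (b :: ps ++ ss) ->
  k != b -> beyond k i X ->
  covers (supply (b :: ps) ss ++ X) ([::] :: supply ps ss ++ X).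
Proof.
move=> h2 /andP[bL _] bk Xk.
have bN t : b :: t \notin supply ps ss ++ X.
  rewrite mem_cat negb_or (beyond_other _ Xk) 1?eq_sym // andbT.
  by apply: contra bL; exact: supply_head.
apply: (@covers_trans _ ([:: b; 0] :: [:: b] :: supply ps ss ++ X)).
  apply: covers_sub => y.
  rewrite /supply /= !(inE, mem_cat) /=.
  by do ![case/orP]; move=> ->; rewrite ?orbT.
apply: covers_jump => //; first exact: ltnW.
- by right; exists 0.
- by left; exists b.
- by rewrite eqseq_cons andbF.
Qed.

(** * Climbing down a branch *)

(** A peg at depth j on the path to x becomes a peg at depth i. The cost of a peg
    at depth i is fib i.+1 arrivals at the root and fib i jumps over the root,
    and a peg at depth j has already paid its share. Both costs satisfy the
    Fibonacci recurrence because a peg at depth i.+2 is made by climbing from j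
    to i.+1, refilling the root with one pair, climbing from the root to i while
    the peg at depth i.+1 waits in X, and jumping. *)
Lemma covers_climb x i j m n ps ss X :
  i <= h -> i <= size x -> j <= i ->
  m + fib j.+1 = fib i.+1 -> n + fib j = fib i ->
  m <= size ps -> n <= size ss ->
  uniq (ps ++ ss) -> head 0 x \notin ps ++ ss -> beyond (head 0 x) i X ->
  covers (take j x :: supply ps ss ++ X)
         (take i x :: supply (drop m ps) (drop n ss) ++ X).
Proof.
set k := head 0 x.
have drop_uniq (a b : nat) (s t : seq nat) : uniq (s ++ t) -> uniq (drop a s ++ drop b t).
  by apply: subseq_uniq; apply: cat_subseq; exact: drop_subseq.
have drop_notin (a b c : nat) (s t : seq nat) : c \notin s ++ t -> c \notin drop a s ++ drop b t.
  by apply: contra; rewrite !mem_cat => /orP[] /mem_drop ->; rewrite ?orbT.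
have fib0 : fib 0 = 0 by [].
have fib1 : fib 1 = 1 by [].
have fib2 : fib 2 = 1 by [].
elim/ltn_ind: i j m n ps ss X => i IH j m n ps ss X ih ix.
rewrite leq_eqVlt => /orP[/eqP <-|ji] mE nE mps nss Luniq Lk Xk.
  have -> : m = 0 by lia.
  have -> : n = 0 by lia.
  by rewrite !drop0; exact: covers_sub.
case: i => [//|[|i]] in IH ih ix ji mE nE Xk *.
  have j0 : j = 0 by lia.
  rewrite {}j0 in mE nE *.
  have -> : m = 0 by lia.
  have n1 : n = 1 by lia.
  rewrite {}n1 in nss *.
  case: ss => // a ss in nss Luniq Lk *; rewrite take0 !drop0 /= drop0.
  have ak : a != k by apply: contra Lk => /eqP <-; rewrite mem_cat mem_head orbT.
  apply: (@covers_trans _ ([:: a] :: [::] :: supply ps ss ++ X)).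
    apply: covers_sub => y.
    rewrite /supply /= !(inE, mem_cat) /=.
    by do ![case/orP]; move=> ->; rewrite ?orbT.
  case: x => [//|c x] in k IH ix Lk Xk ak *; rewrite take_cons take0.
  apply: covers_jump => //.
  - by right; exists a.
  - by right; exists c.
  - rewrite mem_cat negb_or (beyond_other _ Xk) // andbT.
    move: Luniq; rewrite cat_uniq /= => /and4P[_ /norP[aps _] ass _].
    by apply/negP => /supply_head; rewrite mem_cat (negPf aps) (negPf ass).
  - by rewrite mem_cat negb_or supply_nil (beyond_short Xk).
have fj := @fib_homo j.+1 i.+2 ji.
have fj' := @fib_homo j i.+1 ji.
have mE' := fibSS i.+1; have nE' := fibSS i; have fi := fib_gt0 i.
(* The cost of the climb from j to i.+1; the remainder, fib i.+1 arrivals and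
   fib i jumps, pays for the peg at depth i. *)
pose m1 := m - fib i.+1; pose n1 := n - fib i.
have m1ps : m1 < size ps by lia.
apply: (covers_trans (IH i.+1 _ j m1 n1 ps ss X _ _ _ _ _ _ _ _ _ _)) => //; try lia.
  by move=> y /Xk[? ?]; split; lia.
set v1 := take i.+1 x.
have sv1 : size v1 = i.+1 by rewrite size_takel //; lia.
have hv1 t : head t v1 = k by rewrite /v1 /k; case: (x) ix.
have Xv1 : beyond k i (v1 :: X).
  move=> y; rewrite inE => /orP[/eqP->|/Xk[? ?]]; last by split=> //; lia.
  by rewrite sv1 hv1.
have := drop_uniq m1 n1 _ _ Luniq; have := drop_notin m1 n1 _ _ _ Lk.
rewrite (drop_nth 0 m1ps); set b := nth 0 ps m1.
set ps2 := drop _ _; set ss2 := drop n1 _; move=> Lk2 Luniq2.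
apply: (@covers_trans _ (supply (b :: ps2) ss2 ++ (v1 :: X))).
  apply: covers_sub => y; move: (supply _ _) => S; rewrite !(inE, mem_cat).
  by case/or3P => ->; rewrite ?orbT.
apply: covers_trans (covers_root _ Luniq2 _ Xv1) _; first lia.
  by move: Lk2; rewrite inE negb_or => /andP[].
have {}Luniq2 : uniq (ps2 ++ ss2) by move: Luniq2 => /andP[].
have {}Lk2 : k \notin ps2 ++ ss2 by move: Lk2; rewrite inE negb_or => /andP[].
(* The pair b has paid for the peg on the root, whence the predecessor. *)
have := IH i _ 0 (fib i.+1).-1 (fib i) ps2 ss2 (v1 :: X).
rewrite take0 => H.
apply: (covers_trans (H _ _ _ _ _ _ _ _ _ _ _)); rewrite ?size_drop //; try lia.
rewrite /ps2 /ss2 !drop_drop.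
have -> : (fib i.+1).-1 + m1.+1 = m by lia.
have -> : fib i + n1 = n by lia.
set v0 := take i x; set v2 := take i.+2 x.
have sv0 : size v0 = i by rewrite size_takel //; lia.
have hv0 : head k v0 = k by rewrite /v0 /k; case: (x) ix => //; case: (i).
apply: (@covers_trans _ (v0 :: v1 :: supply (drop m ps) (drop n ss) ++ X)).
  apply: covers_sub => y; move: (supply _ _) => S; rewrite !(inE, mem_cat).
  by case/or4P => ->; rewrite ?orbT.
have take_supply y : head k y = k -> y \notin supply (drop m ps) (drop n ss).
  case: y => [_|c y /= ->]; first exact: supply_nil.
  by apply/negP => /supply_head; apply/negP; exact: drop_notin.
have v1E : v1 = rcons v0 (nth 0 x i) by rewrite /v1 (take_nth 0) //; lia.
have v2E : v2 = rcons v1 (nth 0 x i.+1) by rewrite /v2 (take_nth 0) //; lia.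
apply: covers_jump; rewrite ?sv0 ?sv1 //; try lia.
- by rewrite size_takel.
- by left; exists (nth 0 x i).
- by right; exists (nth 0 x i.+1).
- by apply/eqP => /(congr1 size); rewrite sv0 sv1; lia.
- by rewrite mem_cat negb_or take_supply // (beyond_short Xk) // sv0; lia.
- by rewrite mem_cat negb_or take_supply // (beyond_short Xk) // sv1; lia.
Qed.

(** * An optimal distribution *)

Definition optimal_words : seq (seq nat) :=
  [::] :: supply (iota 0 (fib h.+1).-1) (iota (fib h.+1).-1 (fib h)).

Lemma optimal_words_uniq : uniq optimal_words.
Proof.
rewrite /optimal_words; set N := (fib h.+1).-1.
rewrite cons_uniq supply_nil /supply !cat_uniq !map_inj_uniq ?iota_uniq //=;
  try by move=> ? ? [].
rewrite andbT; apply/andP; split.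
  apply/hasPn => y; rewrite mem_cat => /orP[] /mapP[a aL ->] /=.
    by apply/negP => /mapP[].
  apply/negP => /mapP[b bL [ab]]; move: aL bL; rewrite ab !mem_iota; lia.
by apply/hasPn => y /mapP[a aL ->] /=; apply/negP => /mapP[].
Qed.

Lemma size_optimal_words : size optimal_words = fib (h + 3) - 1.
Proof.
rewrite [LHS]/= !size_cat !size_map !size_iota addn3.
have := fib_gt0 h; have := fibSS h.+1; have := fibSS h; lia.
Qed.

(** For h = 0 both lists are empty, and for h = 1 there are no pairs. *)
Lemma optimal_words_height y : y \in optimal_words -> size y <= h.
Proof.
rewrite inE => /orP[/eqP->//|]; rewrite !mem_cat => /or3P[] /mapP[a + ->] /=;
  rewrite mem_iota; case: h => [|[|n]] //=; lia.
Qed.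

(** When the branch of x holds pegs, its entry k is removed from both lists, at
    the cost of one entry of one of them; the climb then starts at depth 2, where
    fib 3 = 2 arrivals at the root and fib 2 = 1 jump over it are already paid
    for, against the single arrival that the root peg pays for in a climb from
    the root. *)
Lemma covers_optimal_words x : size x <= h -> covers optimal_words [:: x].
Proof.
case: x => [_|k t xh]; first by apply: covers_sub => y; rewrite !inE => /eqP->.
set x := k :: t; set ps := iota 0 (fib h.+1).-1; set ss := iota (fib h.+1).-1 (fib h).
have Luniq : uniq (ps ++ ss) by rewrite -iotaD iota_uniq.
have sps : size ps = (fib h.+1).-1 by rewrite size_iota.
have sss : size ss = fib h by rewrite size_iota.
have fd := @fib_homo (size x).+1 h.+1 xh; have fd' := @fib_homo (size x) h xh.
have fd0 : 0 < fib (size x) := fib_gt0 _.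
have fd1 : 0 < fib (size x).+1 := fib_gt0 _.
have fib0 : fib 0 = 0 by [].
have fib1 : fib 1 = 1 by [].
have fib2 : fib 2 = 1 by [].
have fib3 : fib 3 = 2 by [].
have beyond0 i : beyond k i [::] by [].
have [kL|kL] := boolP (k \in ps ++ ss); last first.
  have := @covers_climb x (size x) 0 (fib (size x).+1).-1 (fib (size x)) ps ss [::].
  rewrite take0 take_size !cats0 => H.
  apply: covers_trans (H _ _ _ _ _ _ _ _ _ _) _; rewrite ?sps ?sss //; try lia.
  by apply: covers_sub => y; rewrite !inE => ->.
have k1L : [:: k] \in supply ps ss.
  move: kL; rewrite /supply !mem_cat => /orP[kL|kL].
    by rewrite (map_f (fun b => [:: b]) kL).
  by rewrite (map_f (fun b => [:: b]) kL) !orbT.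
(* If x is [:: k] itself, it holds a peg. *)
have [t0|t0] := posnP (size t).
  apply: covers_sub => y; rewrite !inE => /eqP->.
  by rewrite /x (size0nil t0) k1L orbT.
pose ps' := rem k ps; pose ss' := rem k ss.
have size_rem_ge s : (size s).-1 <= size (rem k s).
  by have [/size_rem->//|/rem_id->] := boolP (k \in s); exact: leq_pred.
have sps' : (size ps).-1 <= size ps' := size_rem_ge ps.
have sss' : (size ss).-1 <= size ss' := size_rem_ge ss.
have Luniq' : uniq (ps' ++ ss').
  by apply: subseq_uniq Luniq; apply: cat_subseq; exact: rem_subseq.
have kL' : k \notin ps' ++ ss' by rewrite mem_cat !mem_rem_uniqF // iota_uniq.
have Lsub : {subset supply ps' ss' <= supply ps ss}.
  by apply: supply_sub => y; exact: mem_rem.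
apply: (@covers_trans _ [:: [::], [:: k] & supply ps' ss']).
  apply: covers_sub => y; rewrite !inE => /or3P[/eqP->|/eqP->|/Lsub->].
  - by [].
  - by rewrite k1L orbT.
  - by rewrite orbT.
(* The root peg jumps over [:: k]; this works whether or not the pegs in the
   branch of k lie on the path to x. *)
have x2 : take 2 x = [:: k; head 0 t] by rewrite /x; case: (t) t0 => //= c t'; rewrite take0.
have xh2 : 1 < h by move: xh => /=; lia.
apply: (@covers_trans _ (take 2 x :: supply ps' ss')).
  rewrite x2; apply: covers_jump => //; first exact: ltnW.
  - by left; exists k.
  - by right; exists (head 0 t).
  - exact: supply_nil.
  - by apply/negP => /supply_head; apply/negP.
have fdx : fib 3 <= fib (size x).+1 by apply: fib_homo => /=; lia.
have := @covers_climb x (size x) 2 (fib (size x).+1 - 2) (fib (size x)).-1 ps' ss' [::].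
rewrite take_size !cats0 => H.
apply: covers_trans (H _ _ _ _ _ _ _ _ _ _) _ => //; try lia.
by apply: covers_sub => y; rewrite !inE => ->.
Qed.

Lemma optimal_words_peg :
  exists2 D : set (inftree h), can_be_pegged_by D & D #= `I_(fib (h + 3) - 1).
Proof.
exists [set v : inftree h | val v \in optimal_words].
  apply/seteqP; split=> // x _.
  have [D' DD' D'x] := covers_optimal_words (valP x) (fun v => id).
  by exists D' => //; apply: D'x; rewrite mem_head.
rewrite -size_optimal_words.
pose node i : inftree_vertex h :=
  insubd (exist _ [::] (leq0n h) : inftree_vertex h) (nth [::] optimal_words i).
have nodeE i : i < size optimal_words -> val (node i) = nth [::] optimal_words i.
  by move=> iL; rewrite val_insubd optimal_words_height ?mem_nth.
have -> : [set v : inftree h | val v \in optimal_words]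
    = node @` `I_(size optimal_words).
  apply/seteqP; split=> [v /= vL|_ [i /= iL <-]]; last by rewrite /= nodeE ?mem_nth.
  have iL : index (val v) optimal_words < size optimal_words by rewrite index_mem.
  by exists (index (val v) optimal_words); [|apply: val_inj; rewrite nodeE ?nth_index].
apply: inj_card_eq => i j /set_mem /= iL /set_mem /= jL /(congr1 val).
by rewrite !nodeE // => /eqP; rewrite nth_uniq ?optimal_words_uniq // => /eqP.
Qed.

End InfTree.

Theorem theorem5p2 (h : nat) :
  optimal_pegging_number (inftree h) (fib (h + 3) - 1).
Proof. by split; [exact: optimal_words_peg|exact: pegging_size_ge]. Qed.
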